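(* Assume the log uniform prior is used for the weights $\boldsymbol W$ and that there exists some weight $w\in\boldsymbol W$ such that the likelihood function at $w=0$ is continuous in $w$ and non-zero. Then the posterior is improper.
   Context: $\boldsymbol W$ is the collection of the $D$ real-valued weights of a discriminative probabilistic model (e.g. a Bayesian neural network). The likelihood function is $p(\boldsymbol Y\mid\boldsymbol X,\boldsymbol W)\ge0$ viewed as a function of $\boldsymbol W\in\mathbb R^D$ for fixed observed data $(\boldsymbol X,\boldsymbol Y)$. The log uniform prior factorises over the individual weights, with (improper) density $p(w)=C/|w|$ for each $w\in\boldsymbol W$, $C$ being treated as a positive finite constant. The posterior density is proportional to $p(\boldsymbol Y\mid\boldsymbol X,\boldsymbol W)\,p(\boldsymbol W)$; the posterior is improper if the normaliser $\int_{\mathbb R^D}p(\boldsymbol Y\mid\boldsymbol X,\boldsymbol W)\,p(\boldsymbol W)\,d\boldsymbol W$ is not finite. *)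

(* Defs.v *)
From HB Require Import structures.
From mathcomp Require Import all_boot all_order all_algebra.
From mathcomp Require Import all_classical all_reals all_analysis.

Set Implicit Arguments.
Unset Strict Implicit.
Unset Printing Implicit Defensive.

Import Order.TTheory GRing.Theory Num.Theory.
Import numFieldNormedType.Exports.

Local Open Scope classical_set_scope.
Local Open Scope ring_scope.

Definition tuple_cons {T : Type} {n : nat} (x : T * n.-tuple T) :
  n.+1.-tuple T := [tuple of x.1 :: x.2].

(* Lebesgue measure on R^n as an iterated product; [lebesgue_tuple_box] below
   gives its values on boxes, which determine it. *)
Fixpoint lebesgue_tuple (R : realType) (n : nat) : set (n.-tuple R) -> \bar R :=
  match n with
  | 0 => dirac [tuple]
  | m.+1 => pushforward (product_measure1 (@lebesgue_measure R)
                                          (@lebesgue_tuple R m)) tuple_cons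
  end.

Section lebesgue_tuple_measure.
Context (R : realType).
Local Open Scope ereal_scope.

Lemma measurable_tuple_cons n :
  measurable_fun [set: measurableTypeR R * n.-tuple R] (@tuple_cons R n).
Proof. exact: (measurable_cons measurable_fst measurable_snd). Qed.

Lemma measurable_thead n :
  measurable_fun [set: n.+1.-tuple R] (@thead n R).
Proof. exact: measurable_tnth. Qed.

Lemma lebesgue_tuple_measureP n :
  exists m : {sigma_finite_measure set (n.-tuple R) -> \bar R},
    @lebesgue_tuple R n = m.
Proof.
elim: n => [|n [m mE]]; first by exists (dirac [tuple]).
pose lm : {measure set (measurableTypeR R * n.-tuple R) -> \bar R} :=
  (@lebesgue_measure R \x m).
pose p : {measure set (n.+1.-tuple R) -> \bar R} :=
  measure_function_pushforward__canonical__measure_function_Measure lm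
    (@measurable_tuple_cons n).
have pE : @lebesgue_tuple R n.+1 = p by rewrite /= mE.
have sp : sigma_finite setT p.
  have /sigma_finiteP[F [FT Fnd Foo]] := sigma_finiteT (@lebesgue_measure R).
  have /sigma_finiteP[G [GT Gnd Goo]] := sigma_finiteT m.
  exists (fun k => [set t : n.+1.-tuple R |
      F k (thead t) /\ G k [tuple of behead t]]).
    apply/esym; rewrite -subTset => t _.
    have [i _ Fi] : (\bigcup_i F i) (thead t) by rewrite -FT.
    have [j _ Gj] : (\bigcup_i G i) [tuple of behead t] by rewrite -GT.
    exists (maxn i j) => //; split.
      exact: (subsetPset _ _ (Fnd _ _ (leq_maxl i j))).
    exact: (subsetPset _ _ (Gnd _ _ (leq_maxr i j))).
  move=> k; have [mF Fk] := Foo k; have [mG Gk] := Goo k; split.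
    apply: measurableI.
      by rewrite -[X in measurable X]setTI; exact: measurable_thead.
    by rewrite -[X in measurable X]setTI; exact: measurable_behead.
  rewrite /= /pushforward.
  rewrite (_ : _ @^-1` _ = F k `*` G k); last first.
    apply/seteqP; split=> -[x y] /= [Fx Gy]; split=> //=.
      by rewrite (_ : y = [tuple of behead (tuple_cons (x, y))])//; exact/val_inj.
    by rewrite (_ : [tuple of _] = y)//; exact/val_inj.
  rewrite [ltLHS](product_measure1E _ _ mF mG).
  by rewrite lte_mul_pinfty// ge0_fin_numE.
pose s : {sigma_finite_measure set (n.+1.-tuple R) -> \bar R} :=
  HB.pack (p : set _ -> \bar R) (Measure.class p)
    (isSFinite.Build _ _ _ p (sfinite_measure_sigma_finite sp))
    (isSigmaFinite.Build _ _ _ p sp).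
by exists s; rewrite pE.
Qed.

Let lebesgue_tuple0 n : @lebesgue_tuple R n set0 = 0.
Proof. by have [m ->] := lebesgue_tuple_measureP n; exact: measure0. Qed.

Let lebesgue_tuple_ge0 n A : 0 <= @lebesgue_tuple R n A.
Proof. by have [m ->] := lebesgue_tuple_measureP n; exact: measure_ge0. Qed.

Let lebesgue_tuple_sigma_additive n : semi_sigma_additive (@lebesgue_tuple R n).
Proof.
by have [m ->] := lebesgue_tuple_measureP n; exact: measure_semi_sigma_additive.
Qed.

HB.instance Definition _ n := isMeasure.Build _ _ _ (@lebesgue_tuple R n)
  (@lebesgue_tuple0 n) (@lebesgue_tuple_ge0 n)
  (@lebesgue_tuple_sigma_additive n).

Let lebesgue_tuple_sigma_finite n : sigma_finite setT (@lebesgue_tuple R n).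
Proof. by have [m ->] := lebesgue_tuple_measureP n; exact: sigma_finiteT. Qed.

HB.instance Definition _ n := @Measure_isSigmaFinite.Build _ _ _ (@lebesgue_tuple R n)
  (@lebesgue_tuple_sigma_finite n).

Lemma lebesgue_tuple_box n (A : 'I_n -> set R) :
  (forall i, measurable (A i)) ->
  @lebesgue_tuple R n [set t | forall i, A i (tnth t i)] =
  \prod_(i < n) @lebesgue_measure R (A i).
Proof.
elim: n A => [|n ih] A mA.
  by rewrite big_ord0 /= diracE mem_set// => -[].
rewrite big_ord_recl -ih//=.
pose B := [set t : n.-tuple R | forall i, A (lift ord0 i) (tnth t i)].
have mB : measurable B.
  rewrite (_ : B = \bigcap_(i in [set: 'I_n])
      (fun t : n.-tuple R => tnth t i) @^-1` A (lift ord0 i)).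
    apply: fin_bigcap_measurable => // i _.
    by rewrite -[X in measurable X]setTI; exact: measurable_tnth.
  by apply/seteqP; split=> t H i => [_|]; [exact: H | exact: (H i)].
rewrite /pushforward (_ : _ @^-1` _ = A ord0 `*` B); last first.
  apply/seteqP; split=> -[x y] /= H; rewrite /B/=.
    split; first exact: (H ord0).
    by move=> i; have := H (lift ord0 i); rewrite tnthS.
  move=> i; case: (unliftP ord0 i) => [j|] ->; first by rewrite tnthS; apply: H.2.
  exact: H.1.
exact: (product_measure1E (@lebesgue_measure R) (@lebesgue_tuple R n)
  (mA ord0) mB).
Qed.

End lebesgue_tuple_measure.

(* The value at [w = 0] is irrelevant (here [C / 0 = 0]): it only matters on a
   Lebesgue-null set. *)
Definition log_uniform (R : realType) (C w : R) : R := C / `|w|.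

Definition log_uniform_prior (R : realType) (D : nat) (C : R)
    (W : D.-tuple R) : R :=
  \prod_(j < D) log_uniform C (tnth W j).

Definition set_weight (R : realType) (D : nat) (W : D.-tuple R) (i : 'I_D)
    (w : R) : D.-tuple R :=
  [tuple if j == i then w else tnth W j | j < D].

Definition posterior_normaliser (R : realType) (D : nat)
    (likelihood prior : D.-tuple R -> R) : \bar R :=
  (\int[@lebesgue_tuple R D]_W (likelihood W * prior W)%:E)%E.

Definition improper_posterior (R : realType) (D : nat)
    (likelihood prior : D.-tuple R -> R) : Prop :=
  ~ (posterior_normaliser likelihood prior \is a fin_num).

(* Main.v *)
(* Fix the other weights at nonzero values. Near [w = 0] the likelihood stays
   above half its positive value at [0], so the integral over [w] dominates a
   multiple of the divergent integral of [1 / w]. By Tonelli the normaliser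
   integrates this infinite inner integral over a set of positive measure. *)

Require Import Defs.
From HB Require Import structures.
From mathcomp Require Import all_boot all_order all_algebra.
From mathcomp Require Import all_classical all_reals all_analysis.
From mathcomp Require Import measurable_realfun.

Set Implicit Arguments.
Unset Strict Implicit.
Unset Printing Implicit Defensive.

Import Order.TTheory GRing.Theory Num.Theory.
Import numFieldNormedType.Exports.

Local Open Scope classical_set_scope.
Local Open Scope ring_scope.

(** * Infinite integrals over tuples *)

Lemma ge0_integral_pinfty_on (d : measure_display) (T : measurableType d)
    (R : realType) (mu : {measure set T -> \bar R}) (D : set T)
    (f : T -> \bar R) :
  measurable D -> mu D != 0%E -> measurable_fun setT f ->
  (forall x, 0 <= f x)%E -> (forall x, D x -> f x = +oo%E) ->
  (\int[mu]_x f x = +oo)%E.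
Proof.
move=> mD muD mf f0 foo; apply/eqP; rewrite -leye_eq.
apply: (@le_trans _ _ (\int[mu]_(x in D) f x)%E); last exact: ge0_subset_integral.
rewrite (eq_integral (cst +oo%E)) => [|x]; last by rewrite inE => /foo.
by rewrite integral_cst// gt0_mulye// lt0e muD measure_ge0.
Qed.

Lemma lebesgue_tuple_box_neq0 (R : realType) (n : nat) (A : set R) :
  measurable A -> @lebesgue_measure R A != 0%E ->
  @lebesgue_tuple R n [set t | forall i, A (tnth t i)] != 0%E.
Proof.
move=> mA A0; rewrite (lebesgue_tuple_box (A := fun=> A))//.
by elim/big_ind : _ => // x y; exact: mule_neq0.
Qed.

Lemma measurable_box (R : realType) (n : nat) (A : set R) :
  measurable A -> measurable [set t : n.-tuple R | forall i, A (tnth t i)].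
Proof.
move=> mA.
rewrite (_ : mkset _ = \bigcap_(i in [set: 'I_n])
    (fun t : n.-tuple R => tnth t i) @^-1` A).
  apply: fin_bigcap_measurable => // i _.
  by rewrite -[X in measurable X]setTI; exact: measurable_tnth.
by apply/seteqP; split=> t H i => [_|]; [exact: H | exact: (H i)].
Qed.

(** Change of variables along [tuple_cons], whose pushforward defines the measure; it exposes a
    product measure to which Tonelli applies. *)
Lemma ge0_integral_lebesgue_tupleS (R : realType) (n : nat)
    (f : n.+1.-tuple R -> \bar R) :
  measurable_fun setT f -> (forall t, 0 <= f t)%E ->
  (\int[@lebesgue_tuple R n.+1]_t f t =
   \int[@lebesgue_measure R \x @lebesgue_tuple R n]_z f (tuple_cons z))%E.
Proof.
move=> mf f0.
exact: (ge0_integral_pushforward (@measurable_tuple_cons R n)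
  (@lebesgue_measure R \x @lebesgue_tuple R n)%E measurableT mf (fun t _ => f0 t)).
Qed.

Lemma set_weight_cons0 (R : realType) (n : nat) (x w : R) (y : n.-tuple R) :
  set_weight (tuple_cons (x, y)) ord0 w = tuple_cons (w, y).
Proof.
apply: eq_from_tnth => j; rewrite tnth_mktuple.
by case: (unliftP ord0 j) => [k|] ->; rewrite ?tnthS.
Qed.

Lemma set_weight_consS (R : realType) (n : nat) (x w : R) (y : n.-tuple R)
    (i : 'I_n) :
  set_weight (tuple_cons (x, y)) (lift ord0 i) w =
  tuple_cons (x, set_weight y i w).
Proof.
apply: eq_from_tnth => j; rewrite tnth_mktuple.
case: (unliftP ord0 j) => [k|] -> //.
by rewrite (inj_eq lift_inj) !tnthS tnth_mktuple.
Qed.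

(** Induction on [n], splitting off the first coordinate. Tonelli allows either order of
    integration, so the block containing coordinate [i] is taken innermost; the inner integral is
    then infinite whenever the outer variable lies in [A] or in the box over [A], a set of nonzero
    measure. *)
Lemma ge0_integral_lebesgue_tuple_pinfty (R : realType) (n : nat) (i : 'I_n)
    (A : set R) (f : n.-tuple R -> \bar R) :
  measurable A -> @lebesgue_measure R A != 0%E ->
  measurable_fun setT f -> (forall t, 0 <= f t)%E ->
  (forall t, (forall j, A (tnth t j)) ->
    \int[@lebesgue_measure R]_w f (set_weight t i w) = +oo)%E ->
  (\int[@lebesgue_tuple R n]_t f t = +oo)%E.
Proof.
move=> mA A0; elim: n i f => [[]//|n ih] i f mf f0 foo.
have mfc : measurable_fun [set: measurableTypeR R * n.-tuple R]
    (f \o @tuple_cons R n).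
  by apply: measurableT_comp => //; exact: measurable_tuple_cons.
have fc0 z : (0 <= (f \o @tuple_cons R n) z)%E by exact: f0.
(* [foo] asks for a complete tuple in the box, including the entry that [set_weight] overwrites; [a]
   fills that entry. *)
have /set0P[a Aa] : A != set0 by apply: contra_neq A0 => ->; exact: measure0.
have Acons x (y : n.-tuple R) : A x -> (forall j, A (tnth y j)) ->
    forall j, A (tnth (tuple_cons (x, y)) j).
  by move=> Ax Ay j; case: (unliftP ord0 j) => [k|] -> //; rewrite tnthS.
rewrite ge0_integral_lebesgue_tupleS//.
have [k ik|i0] := unliftP ord0 i; last first.
  (* Coordinate [i] is the head: integrate over the head first, the tail being fixed. *)
  apply: (eq_trans (@fubini_tonelli2 _ _ _ _ _ (@lebesgue_measure R)
    (@lebesgue_tuple R n) _ mfc fc0)).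
  apply: (@ge0_integral_pinfty_on _ _ _ _ [set t | forall j, A (tnth t j)]).
  - exact: measurable_box.
  - exact: lebesgue_tuple_box_neq0.
  - exact: measurable_fun_fubini_tonelli_G.
  - by move=> y; exact: integral_ge0.
  move=> y Ay; rewrite -[RHS](foo _ (Acons _ _ Aa Ay)) i0.
  by apply: eq_integral => w _; rewrite set_weight_cons0.
(* Coordinate [i] lies in the tail: integrate over the tail first, where the induction hypothesis
   applies for each head [x] in [A]. *)
apply: (eq_trans (@fubini_tonelli1 _ _ _ _ _ (@lebesgue_measure R)
  (@lebesgue_tuple R n) _ mfc fc0)).
apply: (@ge0_integral_pinfty_on _ (measurableTypeR R) R (@lebesgue_measure R) A) => //.
- exact: measurable_fun_fubini_tonelli_F.
- by move=> x; exact: integral_ge0.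
move=> x Ax; apply: (ih k) => [|t|y Ay]; last 1 first.
- rewrite -[RHS](foo _ (Acons _ _ Ax Ay)) ik.
  by apply: eq_integral => w _; rewrite set_weight_consS.
- exact: measurableT_comp.
- exact: f0.
Qed.

(** * Divergence of the integral of [1 / x] at 0 *)

Lemma integral_inv (R : realType) (a b : R) : 0 < a -> a < b ->
  (\int[@lebesgue_measure R]_(x in `[a, b]) (x^-1)%:E = (ln b - ln a)%:E)%E.
Proof.
move=> a0 ab; have pos x : x \in `[a, b] -> 0 < x.
  by rewrite in_itv/= => /andP[ax _]; exact: lt_le_trans ax.
have dln x : x \in `]a, b[ -> is_derive x 1 (@ln R) x^-1.
  by move=> /subset_itv_oo_cc xab; apply: is_derive1_ln; exact: pos.
rewrite (@continuous_FTC2 R (fun x => x^-1) (@ln R) a b)//.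
- apply: continuous_in_subspaceT => x /[!inE] /pos x0.
  by apply: inv_continuous; rewrite gt_eqF.
- split.
  + by move=> x /dln[].
  + exact/cvg_at_right_filter/continuous_ln.
  + exact/cvg_at_left_filter/continuous_ln/(lt_trans a0).
- by move=> x /dln[_ <-]; rewrite derive1E.
Qed.

Lemma ge0_integral_inv_pinfty (R : realType) (c d : R) (f : R -> \bar R) :
  0 < c -> 0 < d -> measurable_fun setT f -> (forall x, 0 <= f x)%E ->
  (forall x, 0 < x <= d -> ((c / x)%:E <= f x)%E) ->
  (\int[@lebesgue_measure R]_x f x = +oo)%E.
Proof.
move=> c0 d0 mf f0 cf; apply/eqyP => M M0.
(* Chosen so that [c * (ln d - ln a) = M]: the integral of [c / x] over [[a, d]] already reaches the
   arbitrary bound [M]. *)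
pose a := d * expR (- (M / c)).
have a0 : 0 < a by rewrite mulr_gt0// expR_gt0.
have ad : a < d by rewrite gtr_pMr// expR_lt1 oppr_lt0 divr_gt0.
have mc : measurable_fun `[a, d] (fun x : R => x^-1).
  apply: subspace_continuous_measurable_fun => //.
  apply: continuous_in_subspaceT => x /[!inE]; rewrite /= in_itv/= => /andP[ax _].
  by apply: inv_continuous; rewrite gt_eqF// (lt_le_trans a0).
have pos x : x \in `[a, d] -> 0 < x <= d.
  by rewrite /= in_itv/= => /andP[ax ->]; rewrite (lt_le_trans a0).
apply: (@le_trans _ _ (\int[lebesgue_measure]_(x in `[a, d]) f x)%E); last first.
  exact: ge0_subset_integral.
apply: (@le_trans _ _ (\int[lebesgue_measure]_(x in `[a, d]) (c%:E * (x^-1)%:E))%E).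
  rewrite ge0_integralZl//=; last 3 first.
  - exact/measurable_EFinP.
  - by move=> x /pos/andP[x0 _]; rewrite lee_fin invr_ge0 ltW.
  - by rewrite lee_fin ltW.
  rewrite integral_inv// lnM ?posrE ?expR_gt0// expRK -EFinM lee_fin.
  by rewrite opprD addNKr opprK mulrC divfK// gt_eqF.
apply: ge0_le_integral => //.
- by move=> x /pos/andP[x0 _]; rewrite lee_fin; exact/ltW/divr_gt0.
- by apply/measurable_EFinP; exact: measurable_funM.
- exact: measurable_funTS.
- by move=> x /pos/cf; rewrite EFinM.
Qed.

(** * The log uniform prior and its slices *)

Lemma measurable_log_uniform (R : realType) (C : R) :
  measurable_fun setT (log_uniform C).
Proof.
(* Inversion becomes a real power, which is measurable; the two agree at 0 as well, both being 0
   there. *)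
rewrite (_ : log_uniform C = (fun w => C * `|w| `^ (-1))).
  apply: measurable_funM => //.
  apply: (@measurableT_comp _ _ _ _ _ _ (fun x : R => x `^ (-1))) => //.
by apply/funext => w; rewrite powR_inv1.
Qed.

Lemma log_uniform_ge0 (R : realType) (C w : R) : 0 <= C -> 0 <= log_uniform C w.
Proof. by move=> C0; exact: divr_ge0. Qed.

Lemma measurable_log_uniform_prior (R : realType) (D : nat) (C : R) :
  measurable_fun setT (@log_uniform_prior R D C).
Proof.
apply: measurable_prod => j _.
exact: (measurableT_comp (@measurable_log_uniform R C) (measurable_tnth j)).
Qed.

Lemma log_uniform_prior_ge0 (R : realType) (D : nat) (C : R) (W : D.-tuple R) :
  0 <= C -> 0 <= log_uniform_prior C W.
Proof. by move=> C0; apply: prodr_ge0 => j _; exact: log_uniform_ge0. Qed.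

Lemma log_uniform_prior_set_weight (R : realType) (D : nat) (C w : R)
    (W : D.-tuple R) (i : 'I_D) :
  log_uniform_prior C (set_weight W i w) =
  log_uniform C w * \prod_(j < D | j != i) log_uniform C (tnth W j).
Proof.
rewrite /log_uniform_prior (bigD1 i)//= tnth_mktuple eqxx; congr (_ * _).
by apply: eq_bigr => j /negPf ji; rewrite tnth_mktuple ji.
Qed.

Lemma measurable_set_weight (R : realType) (D : nat) (W : D.-tuple R)
    (i : 'I_D) : measurable_fun setT (set_weight W i).
Proof.
apply/measurable_fun_tnthP => j.
rewrite (_ : _ \o _ = fun w => if j == i then w else tnth W j).
  by case: (j == i).
by apply/funext => w; rewrite /= tnth_mktuple.
Qed.

Theorem proposition1 (R : realType) (D : nat) (C : R) (C_gt0 : 0 < C)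
    (likelihood : D.-tuple R -> R)
    (likelihood_ge0 : forall W : D.-tuple R, 0 <= likelihood W)
    (measurable_likelihood : measurable_fun [set: D.-tuple R] likelihood) :
  (exists i : 'I_D, forall W : D.-tuple R,
     {for 0, continuous (fun w : R => likelihood (set_weight W i w))} /\
     likelihood (set_weight W i 0) != 0) ->
  improper_posterior likelihood (@log_uniform_prior R D C).
Proof.
move=> [i Hi]; rewrite /improper_posterior /posterior_normaliser.
have mf : measurable_fun setT
    (fun W => (likelihood W * log_uniform_prior C W)%:E).
  apply/measurable_EFinP/measurable_funM => //.
  exact: measurable_log_uniform_prior.
have f0 W : (0 <= (likelihood W * log_uniform_prior C W)%:E)%E.
  by rewrite lee_fin mulr_ge0// log_uniform_prior_ge0// ltW.
(* Slices with a zero coordinate must be avoided: there the prior is 0, as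
   [C / 0 = 0]. *)
rewrite (@ge0_integral_lebesgue_tuple_pinfty R D i [set` `[1, 2]])//.
  by rewrite lebesgue_measure_itv/= lte_fin ltr1n//.
move=> W W12; have [cW W0] := Hi W.
set g := fun w => likelihood (set_weight W i w) in cW.
have g0 : 0 < g 0 by rewrite lt_neqAle eq_sym W0 likelihood_ge0.
(* The prior of the other weights, constant along the slice; it is positive because they lie in
   [[1, 2]]. *)
set K := \prod_(j < D | j != i) log_uniform C (tnth W j).
have K0 : 0 < K.
  apply: prodr_gt0 => j _; rewrite divr_gt0// normr_gt0 gt_eqF//.
  by have := W12 j; rewrite /= in_itv/= => /andP[/(lt_le_trans ltr01)].
have /nbhs_ballP[e /= e0 ge] : \forall w \near 0, g 0 / 2 < g w.
  by apply: (cvgr_gt _ cW); rewrite ltr_pdivrMr// ltr_pMr// ltr1n.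
(* On the slice the integrand is [g w * (C / w * K)] for [w > 0], and [g w > g 0 / 2] in the ball.
   That ball is open while the bound is required up to and including the right endpoint, hence
   [e / 2] instead of [e]. *)
apply: (@ge0_integral_inv_pinfty R (g 0 / 2 * (C * K)) (e / 2)).
- by rewrite !mulr_gt0.
- by rewrite divr_gt0.
- by apply: (measurableT_comp mf); exact: measurable_set_weight.
- by move=> w; exact: f0.
- move=> w /andP[w0 we]; rewrite lee_fin log_uniform_prior_set_weight -/K.
  rewrite /log_uniform gtr0_norm// (mulrAC C) [leRHS]mulrA.
  rewrite ler_pM2r ?invr_gt0// ler_pM2r ?mulr_gt0//; apply/ltW/ge.
  rewrite -ball_normE/= sub0r normrN gtr0_norm// (le_lt_trans we)//.
  by rewrite ltr_pdivrMr// ltr_pMr// ltr1n.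
Qed.
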